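(* Let $K$ be a field of characteristic $0$, let $P=K[x_1,\dots,x_n]$, and let $I\subseteq P$ be a homogeneous ideal generated in degree $\le \delta+1$, where $\delta\in\mathbb{N}$. If there exists $i\in\{1,\dots,n\}$ such that $\mathcal{M}_{P/I}$ has $i$-maximal growth in degree $\delta$, then $\mathcal{M}_{P/I}$ has $j$-maximal growth in degree $d$ for all $j\in\{1,\dots,i\}$ and all degrees $d\ge\delta$.
   Context: $P$ has the standard grading. For a homogeneous ideal $I\subseteq P$, the sectional matrix of $P/I$ is the function $\mathcal{M}_{P/I}:\{1,\dots,n\}\times\mathbb{N}\to\mathbb{N}$, $\mathcal{M}_{P/I}(i,d)=\dim_K\big(P_d/(I+(L_1,\dots,L_{n-i}))_d\big)$, where $L_1,\dots,L_{n-i}$ are generic linear forms (the value is the same for all choices of coefficients in a suitable non-empty Zariski-open set). For $i\in\{1,\dots,n\}$, $\mathcal{M}_{P/I}$ has $i$-maximal growth in degree $d$ if $\mathcal{M}_{P/I}(i,d+1)=\sum_{j=1}^{i}\mathcal{M}_{P/I}(j,d)$. *)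

(* Defs.v *)
From HB Require Import structures.
From mathcomp Require Import all_boot all_order all_algebra.
From mathcomp Require Import mpoly.
From mathcomp Require Import boolp classical_sets.

Set Implicit Arguments.
Unset Strict Implicit.
Unset Printing Implicit Defensive.

Import GRing.Theory.
Local Open Scope ring_scope.
Local Open Scope classical_set_scope.

(* MathComp's own [idealr_closed] is not used: it forces ideals to be proper,
   whereas the unit ideal is allowed here. *)
Definition is_ideal (R : comNzRingType) (I : set R) : Prop :=
  [/\ I 0, forall p q, I p -> I q -> I (p + q) & forall a p, I p -> I (a * p)].

Definition ideal_gen (R : comNzRingType) (G : set R) : set R :=
  [set p | exists (m : nat) (a g : 'I_m -> R),
    (forall k, G (g k)) /\ p = \sum_(k < m) a k * g k].

Definition homogeneous_ideal (K : fieldType) (n : nat)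
    (I : set {mpoly K[n]}) : Prop :=
  is_ideal I /\ forall (d : nat) p, I p -> I (pihomog mdeg d p).

Definition generated_in_degree_le (K : fieldType) (n : nat)
    (I : set {mpoly K[n]}) (e : nat) : Prop :=
  exists G : set {mpoly K[n]},
    (forall g, G g -> exists2 d, (d <= e)%N & g \is d.-homog) /\
    I = ideal_gen G.

(* dim_K (P_d / J_d), with J_d = J `&` P_d: the unique m such that there is a
   K-linear isomorphism P_d / J_d ~ K^m, given here as a surjective linear map
   on P_d with kernel J_d. The default value 0 of [xget] is never used when J
   is an ideal, since P_d is finite-dimensional. *)
Definition quot_dim (K : fieldType) (n : nat) (J : set {mpoly K[n]})
    (d : nat) : nat :=
  xget 0%N [set m | exists f : {linear dhomog n K d -> 'rV[K]_m},
    (forall v, exists p, f p = v) /\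
    (forall p : dhomog n K d, f p = 0 <-> J (val p))].

Definition linear_form (K : fieldType) (n r : nat) (A : 'M[K]_(r, n))
    (k : 'I_r) : {mpoly K[n]} :=
  \sum_(j < n) A k j *: 'X_j.

(* Zariski-open subsets of the affine space of r x n matrices, as complements
   of the common zero locus of a set of polynomials in the r * n entries. *)
Definition zariski_open (K : fieldType) (r n : nat)
    (U : set 'M[K]_(r, n)) : Prop :=
  exists F : set {mpoly K[r * n]},
    U = [set A | exists2 f, F f & f.@[fun k => mxvec A 0 k] != 0].

(* The generic value: the m such that the dimension is m for all coefficients
   in some non-empty Zariski-open set. Over an infinite field and for a
   homogeneous ideal I, such an m exists and is unique. It is meaningful for
   1 <= i <= n. *)
Definition sectional_matrix (K : fieldType) (n : nat) (I : set {mpoly K[n]})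
    (i d : nat) : nat :=
  xget 0%N [set m | exists U : set 'M[K]_(n - i, n),
    [/\ zariski_open U, U !=set0 &
        forall A, U A ->
          quot_dim (ideal_gen (I `|` range (linear_form A))) d = m]].

Definition maximal_growth (K : fieldType) (n : nat) (I : set {mpoly K[n]})
    (i d : nat) : Prop :=
  sectional_matrix I i d.+1 = (\sum_(1 <= j < i.+1) sectional_matrix I j d)%N.

(* Main.v *)
From HB Require Import structures.
Require Import Defs.
From mathcomp Require Import all_boot all_order all_algebra.
From mathcomp Require Import mpoly.
From mathcomp Require Import boolp classical_sets.
From mathcomp Require Import zify ring.

(** Fix linear forms l_0, ..., l_(n-1), the rows of an invertible matrix A, put
    J_k = I + (l_0, ..., l_(k-1)), and let h(k, d) = dim (P / J_k)_d.
    Multiplication by l_k gives an exact sequence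
      (P / J_k)_d -> (P / J_k)_(d+1) -> (P / J_(k+1))_(d+1) -> 0,
    so h(k, d+1) <= h(k, d) + h(k+1, d+1), with equality exactly when l_k acts
    injectively on (P / J_k)_d ([quot_dim_mul]). As h(n, d+1) = 0, summing over
    k >= n - i bounds h(n - i, d+1) by the sum of the h(n - j, d), j = 1, ..., i
    ([growth_leqif]). For generic A this is the bound defining maximal growth,
    hence i-maximal growth in degree d means that, for every k >= n - i, l_k is
    injective on (P / J_k)_d ([maximal_growth_inj_from]). Now passing from i to
    j <= i only drops some of the conditions.

    Passing from d to d+1 is algebra, for one fixed basis of linear forms
    ([inj_fromS]). Let c = n - i, and assume the injectivity in degree d for all
    k >= c. Dividing by the forms one at a time shows
      I_(d+1) `&` (l_0, ..., l_(m-1)) <=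
        \sum_(k < m) l_k I_d + (l_0, ..., l_(c-1))
    for m >= c ([cap_forms_decomp]). Let now f have degree d+1 and l_j f \in J_j,
    where j >= c. As I is generated in degree <= d+1, l_j f is congruent to some
    \sum_(k < m) l_k g_k with g_k \in I_(d+1), modulo (l_0, ..., l_(j-1)). If
    m - 1 > j then l_(m-1) g_(m-1), hence also g_(m-1), lies in
    (l_0, ..., l_(m-2)), because the forms are a regular sequence; the inclusion
    above rewrites g_(m-1) by l_0, ..., l_(m-2) and m decreases. When m - 1 = j,
    regularity gives f - g_j \in (l_0, ..., l_(j-1)), so f \in J_j.

    Only finitely many generic conditions enter each step. Each holds where some
    polynomial that is not identically zero on matrices does not vanish (for the
    dimensions: where a determinant of coordinates is nonzero,
    [generically_quot_dim]). As K is infinite, finitely many of them hold at a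
    common matrix ([generic_basis_exists]). *)

Set Implicit Arguments.
Unset Strict Implicit.
Unset Printing Implicit Defensive.

Import GRing.Theory.
Local Open Scope ring_scope.
Local Open Scope classical_set_scope.

(** * Ideals *)

Section IdealTheory.
Variables (R : comNzRingType) (J : set R).
Hypothesis idJ : is_ideal J.

Lemma ideal0 : J 0. Proof. by case: idJ. Qed.

Lemma idealD p q : J p -> J q -> J (p + q).
Proof. by case: idJ => _ + _; apply. Qed.

Lemma idealMl a p : J p -> J (a * p).
Proof. by case: idJ => _ _; apply. Qed.

Lemma idealN p : J p -> J (- p).
Proof. by rewrite -mulN1r; apply: idealMl. Qed.

Lemma idealB p q : J p -> J q -> J (p - q).
Proof. by move=> Jp /idealN; apply: idealD. Qed.

Lemma ideal_sum (T : Type) (s : seq T) (P : pred T) (F : T -> R) :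
  (forall t, P t -> J (F t)) -> J (\sum_(t <- s | P t) F t).
Proof. by move=> JF; apply: big_ind => //; [exact: ideal0|exact: idealD]. Qed.

End IdealTheory.

Lemma ideal_gen_min (R : comNzRingType) (G J : set R) :
  is_ideal J -> G `<=` J -> ideal_gen G `<=` J.
Proof.
move=> idJ GJ p [m [a [g [Gg ->]]]].
by apply: ideal_sum => // k _; apply: idealMl => //; apply: GJ.
Qed.

Lemma ideal_gen_ideal (R : comNzRingType) (G : set R) : is_ideal (ideal_gen G).
Proof.
split.
- exists 0%N, (fun=> 0), (fun=> 0); split; first by case.
  by rewrite big_ord0.
- move=> _ _ [m [a [g [Gg ->]]]] [m' [a' [g' [Gg' ->]]]].
  pose glue T (u : 'I_m -> T) (u' : 'I_m' -> T) k :=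
    match fintype.split k with inl i => u i | inr i => u' i end.
  exists (m + m')%N, (glue _ a a'), (glue _ g g'); split.
    by move=> k; rewrite /glue; case: fintype.split.
  rewrite big_split_ord /glue /=; congr (_ + _); apply: eq_bigr => i _.
    case: splitP => [j /= /ord_inj -> //|j /= e].
    by have := ltn_ord i; rewrite e ltnNge leq_addr.
  case: splitP => j /= e; last by move/addnI/ord_inj: e => ->.
  by have := ltn_ord j; rewrite -e ltnNge leq_addr.
- move=> b _ [m [a [g [Gg ->]]]]; exists m, (fun k => b * a k), g; split=> //.
  by rewrite mulr_sumr; apply: eq_bigr => k _; rewrite mulrA.
Qed.

Lemma sub_ideal_gen (R : comNzRingType) (G : set R) : G `<=` ideal_gen G.
Proof.
move=> g Gg; exists 1%N, (fun=> 1), (fun=> g); split=> //.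
by rewrite big_ord1 mul1r.
Qed.

(** * Homogeneous components and linear forms *)

Section HomogeneousComponents.
Variables (K : fieldType) (n : nat).
Implicit Types (p q l : {mpoly K[n]}) (d : nat).

Lemma pihomog_mull l d p : l \is 1.-homog ->
  pihomog mdeg d.+1 (l * p) = l * pihomog mdeg d p.
Proof.
move=> hl; rewrite [p in LHS]mpolyE mulr_sumr raddf_sum /= pihomogE mulr_sumr.
rewrite [RHS]big_mkcond /=; apply: eq_bigr => m _.
rewrite -scalerAr linearZ /=.
have h : l * 'X_[m] \is (mdeg m).+1.-homog.
  by rewrite -add1n; apply: dhomogM => //; rewrite dhomogX.
case: eqP => [<-|/eqP ne]; first by rewrite (pihomog_dE h) scalerAr.
by rewrite (pihomog_ne0 _ h) ?scaler0 // eqSS.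
Qed.

Lemma pihomog0_mull l p : l \is 1.-homog -> pihomog mdeg 0 (l * p) = 0.
Proof.
move=> hl; rewrite [p]mpolyE mulr_sumr raddf_sum big1 //= => m _.
rewrite -scalerAr linearZ /= (pihomog_ne0 (d := (mdeg m).+1)) ?scaler0 //.
by rewrite -add1n; apply: dhomogM => //; rewrite dhomogX.
Qed.

Lemma dhomog_mull l d p : l \is 1.-homog -> p \is d.-homog -> l * p \is d.+1.-homog.
Proof. by move=> hl hp; rewrite -add1n; apply: dhomogM. Qed.

Lemma linear_form_homog r (A : 'M[K]_(r, n)) k : linear_form A k \is 1.-homog.
Proof.
rewrite /linear_form; apply: rpred_sum => j _; apply: dhomogZ.
by rewrite dhomogX /= mdeg1.
Qed.

End HomogeneousComponents.

(** * Ideals extended by the first forms of a family *)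

(** The ideal I + (l_0, ..., l_(m-1)). The number m of forms is a natural number
    separate from the size r of the family, so that one family carries the whole
    chain J_0, J_1, ..., J_r. *)
Definition cut (K : fieldType) (n r : nat) (l : 'I_r -> {mpoly K[n]})
    (I : set {mpoly K[n]}) (m : nat) : set {mpoly K[n]} :=
  [set p | exists2 q, I q & exists a : 'I_r -> {mpoly K[n]},
     p = q + \sum_(k < r | (k < m)%N) l k * a k].

Section Cut.
Variables (K : fieldType) (n r : nat) (l : 'I_r -> {mpoly K[n]}).
Variable (I : set {mpoly K[n]}).
Hypothesis idI : is_ideal I.

Lemma cut_ideal m : is_ideal (cut l I m).
Proof.
split.
- exists 0; first exact: ideal0.
  by exists (fun=> 0); rewrite big1 ?addr0 // => k _; rewrite mulr0.
- move=> _ _ [q Iq [a ->]] [q' Iq' [a' ->]].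
  exists (q + q'); first exact: idealD.
  exists (fun k => a k + a' k); rewrite addrACA -big_split /=.
  by congr (_ + _); apply: eq_bigr => k _; rewrite mulrDr.
- move=> b _ [q Iq [a ->]]; exists (b * q); first exact: idealMl.
  exists (fun k => b * a k); rewrite mulrDr mulr_sumr.
  by congr (_ + _); apply: eq_bigr => k _; rewrite mulrCA.
Qed.

Lemma sub_cut m : I `<=` cut l I m.
Proof.
move=> q Iq; exists q => //; exists (fun=> 0).
by rewrite big1 ?addr0 // => k _; rewrite mulr0.
Qed.

Lemma cut_gen m (k : 'I_r) : (k < m)%N -> cut l I m (l k).
Proof.
move=> km; exists 0; first exact: ideal0.
exists (fun i => (i == k)%:R); rewrite (bigD1 k) //= eqxx mulr1 big1 ?addr0 ?add0r //.
by move=> i /andP[_ /negPf ->]; rewrite mulr0.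
Qed.

Lemma cut_min m J : is_ideal J -> I `<=` J ->
  (forall k : 'I_r, (k < m)%N -> J (l k)) -> cut l I m `<=` J.
Proof.
move=> idJ IJ Jl _ [q Iq [a ->]]; apply: idealD => //; first exact: IJ.
by apply: ideal_sum => // k km; rewrite mulrC; apply: idealMl => //; apply: Jl.
Qed.

Lemma cut_mono m m' : (m <= m')%N -> cut l I m `<=` cut l I m'.
Proof.
move=> mm'; apply: cut_min; [exact: cut_ideal|exact: sub_cut|].
by move=> k km; apply: cut_gen; apply: leq_trans mm'.
Qed.

(** The right exactness of (P / J_k)(-1) -> P / J_k -> P / J_(k+1) -> 0. *)
Lemma cutSP (k : 'I_r) p :
  cut l I k.+1 p <-> exists2 q, cut l I k q & exists a, p = q + l k * a.
Proof.
split=> [[q Iq [a ->]]|[q Jq [a ->]]]; last first.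
  apply: (idealD (cut_ideal _)); first exact: cut_mono Jq.
  by rewrite mulrC; apply: (idealMl (cut_ideal _)); apply: cut_gen.
exists (q + \sum_(i < r | (i < k)%N) l i * a i); first by exists q => //; exists a.
exists (a k); rewrite (bigD1 k) //= -addrA [l k * _ + _]addrC; congr (_ + (_ + _)).
by apply: eq_bigl => i; rewrite ltnS [RHS]ltn_neqAle andbC.
Qed.

Lemma cut_homogeneous m : homogeneous_ideal I ->
  (forall k, l k \is 1.-homog) -> homogeneous_ideal (cut l I m).
Proof.
move=> [_ hI] hl; split; first exact: cut_ideal.
move=> d _ [q Iq [a ->]]; exists (pihomog mdeg d q); first exact: hI.
case: d => [|d].
  exists (fun=> 0); rewrite pihomogD raddf_sum /=; congr (_ + _).
  by apply: eq_bigr => k _; rewrite pihomog0_mull ?mulr0.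
exists (fun k => pihomog mdeg d (a k)); rewrite pihomogD raddf_sum /=.
by congr (_ + _); apply: eq_bigr => k _; rewrite pihomog_mull.
Qed.

Lemma cut_ideal_gen : cut l I r = ideal_gen (I `|` range l).
Proof.
apply/seteqP; split.
  apply: cut_min; first exact: ideal_gen_ideal.
    by move=> q Iq; apply: sub_ideal_gen; left.
  by move=> k _; apply: sub_ideal_gen; right; exists k.
apply: ideal_gen_min; first exact: cut_ideal.
by move=> q [Iq|[k _ <-]]; [exact: sub_cut|exact: cut_gen].
Qed.

End Cut.

Lemma cut_widen (K : fieldType) (n r s : nat) (rs : (r <= s)%N)
    (l : 'I_s -> {mpoly K[n]}) (I : set {mpoly K[n]}) : is_ideal I ->
  cut (l \o widen_ord rs) I r = cut l I r.
Proof.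
move=> idI; apply/seteqP; split; apply: cut_min; try exact: cut_ideal; try exact: sub_cut.
  by move=> k kr; apply: cut_gen.
move=> k kr.
have -> : l k = (l \o widen_ord rs) (Ordinal kr) by congr (l _); apply: val_inj.
by apply: cut_gen.
Qed.

Lemma zero_homogeneous (K : fieldType) (n : nat) :
  homogeneous_ideal [set 0 : {mpoly K[n]}].
Proof.
split; last by move=> d p ->; rewrite /= pihomog0.
by split=> [//|p q -> ->|a p ->] /=; rewrite ?addr0 ?mulr0.
Qed.

(** * A basis of linear forms is a regular sequence *)

(** The elements fixed by psi modulo J form a subalgebra. *)
Lemma ideal_subrmorph (K : fieldType) (n : nat) (J : set {mpoly K[n]})
    (psi : {rmorphism {mpoly K[n]} -> {mpoly K[n]}}) :
  is_ideal J -> (forall c : K, psi c%:MP = c%:MP) ->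
  (forall j, J ('X_j - psi 'X_j)) -> forall p, J (p - psi p).
Proof.
move=> idJ psiC JX.
have JM p q : J (p - psi p) -> J (q - psi q) -> J (p * q - psi (p * q)).
  move=> Jp Jq; have -> : p * q - psi (p * q) = q * (p - psi p) + psi p * (q - psi q).
    by rewrite rmorphM /=; ring.
  by apply: idealD => //; apply: idealMl.
have J1 : J (1 - psi 1) by rewrite rmorph1 subrr; apply: ideal0.
have JXm m : J ('X_[m] - psi 'X_[m]).
  rewrite mpolyXE_id; apply: (big_ind (fun p => J (p - psi p))) => // i _.
  by elim: (m i) => [|e IH]; rewrite ?expr0 // exprS; apply: JM.
elim/mpolyind => [|c m p _ _ Jp]; first by rewrite rmorph0 subrr; apply: ideal0.
have -> : c *: 'X_[m] + p - psi (c *: 'X_[m] + p) =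
    c%:MP * ('X_[m] - psi 'X_[m]) + (p - psi p).
  by rewrite -mul_mpolyC rmorphD rmorphM /= psiC; ring.
by apply: idealD => //; apply: idealMl.
Qed.

Section LinearBasis.
Variables (K : fieldType) (n : nat) (A : 'M[K]_n).
Hypothesis uA : A \in unitmx.
Local Notation l := (linear_form A).
Local Notation M := (cut l [set 0]).

Let idM m : is_ideal (M m).
Proof. by apply: cut_ideal; case: (zero_homogeneous K n). Qed.

Lemma mpolyX_linear_form j : 'X_j = \sum_k invmx A j k *: l k :> {mpoly K[n]}.
Proof.
have VA i : \sum_k invmx A j k * A k i = (j == i)%:R.
  by have /matrixP/(_ j i) := mulVmx uA; rewrite !mxE.
under eq_bigr => k _ do rewrite /linear_form scaler_sumr.
rewrite exchange_big /=.
under eq_bigr => i _.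
  under eq_bigr => k _ do rewrite scalerA.
  rewrite -scaler_suml VA; over.
rewrite (bigD1 j) //= eqxx scale1r big1 ?addr0 // => i ij.
by rewrite eq_sym (negPf ij) scale0r.
Qed.

Lemma linear_form_neq0 k : l k != 0.
Proof.
apply/eqP => lk0.
have row0 : row k A = 0.
  apply/rowP => j; rewrite !mxE.
  have := congr1 (mcoeff U_(j)) lk0; rewrite mcoeff0 /linear_form raddf_sum /=.
  rewrite (bigD1 j) //= mcoeffZ mcoeffX eqxx mulr1 big1 ?addr0 // => i ij.
  by rewrite mcoeffZ mcoeffX eq_mnm1 (negPf ij) mulr0.
have /matrixP/(_ k k) := mulmxV uA; rewrite !mxE big1 => [|j _].
  by move/eqP; rewrite eqxx eq_sym oner_eq0.
by have /rowP/(_ j) := row0; rewrite !mxE => ->; rewrite mul0r.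
Qed.

Section Projection.
Variable m : nat.

(** Substituting these images for the variables is the projection of P onto the
    subalgebra generated by l_m, ..., l_(n-1), with kernel (l_0, ..., l_(m-1)). *)
Definition kill_low : n.-tuple {mpoly K[n]} :=
  [tuple \sum_(k < n | (m <= k)%N) invmx A j k *: l k | j < n].

Lemma comp_kill_low_form k : l k \mPo kill_low = if (m <= k)%N then l k else 0.
Proof.
rewrite {1}/linear_form raddf_sum /=.
under eq_bigr => j _ do rewrite comp_mpolyZ comp_mpolyXU -tnth_nth tnth_mktuple scaler_sumr.
rewrite exchange_big /=.
under eq_bigr => i _.
  under eq_bigr => j _ do rewrite scalerA.
  rewrite -scaler_suml; over.
have AV i : \sum_j A k j * invmx A j i = (k == i)%:R.
  by have /matrixP/(_ k i) := mulmxV uA; rewrite !mxE.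
under eq_bigr => i _ do rewrite AV.
case: ifP => mk; last first.
  rewrite big1 // => i mi; case: eqP => [ki|]; rewrite ?scale0r //.
  by rewrite -ki mk in mi.
rewrite (bigD1 k) //= eqxx scale1r big1 ?addr0 // => i /andP[_ ik].
by rewrite eq_sym (negPf ik) scale0r.
Qed.

Lemma sub_comp_kill_low p : M m (p - (p \mPo kill_low)).
Proof.
pose psi : {rmorphism {mpoly K[n]} -> {mpoly K[n]}} :=
  GRing.RMorphism.clone _ _ (comp_mpoly kill_low) _.
apply: (@ideal_subrmorph _ _ _ psi (idM m) _ _ p).
  by move=> c; rewrite /psi /= comp_mpolyC.
move=> j; rewrite /psi /= comp_mpolyXU -tnth_nth tnth_mktuple [X in X - _]mpolyX_linear_form.
rewrite (bigID (fun k : 'I_n => (m <= k)%N)) /= [X in X - _]addrC addrK.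
apply: ideal_sum => // k km; rewrite -mul_mpolyC; apply: idealMl => //.
by apply: cut_gen; rewrite ?ltnNge //; case: (zero_homogeneous K n).
Qed.

Lemma comp_kill_low0 p : M m p -> p \mPo kill_low = 0.
Proof.
case=> _ -> [a ->]; rewrite add0r raddf_sum big1 //= => k km.
by rewrite rmorphM /= comp_kill_low_form leqNgt km mul0r.
Qed.

End Projection.

(** The projection identifies P / (l_0, ..., l_(k-1)) with a subalgebra of the
    domain P, in which l_k is a nonzero element. *)
Lemma linear_form_regular (k : 'I_n) p : M k (l k * p) -> M k p.
Proof.
move=> /comp_kill_low0; rewrite rmorphM /= comp_kill_low_form leqnn.
move/eqP; rewrite mulf_eq0 (negPf (linear_form_neq0 _)) /= => /eqP p0.
by have := sub_comp_kill_low k p; rewrite p0 subr0.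
Qed.

Lemma sub_const_linear_forms p : M n (p - (p.@[fun=> 0])%:MP).
Proof.
pose psi : {rmorphism {mpoly K[n]} -> {mpoly K[n]}} :=
  GRing.RMorphism.clone _ _ (@mpolyC n K \o meval (fun=> 0)) _.
apply: (@ideal_subrmorph _ _ _ psi (idM n) _ _ p).
  by move=> c; rewrite /psi /= mevalC.
move=> j; rewrite /psi /= mevalXU subr0 mpolyX_linear_form.
apply: ideal_sum => // k _; rewrite -mul_mpolyC; apply: idealMl => //.
by apply: cut_gen; rewrite ?ltn_ord //; case: (zero_homogeneous K n).
Qed.

Lemma dhomogS_linear_forms d p : p \is d.+1.-homog -> M n p.
Proof.
move=> hp; rewrite -(pihomog_dE hp).
have hM : homogeneous_ideal (M n).
  apply: cut_homogeneous; first exact: (zero_homogeneous K n).1.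
    exact: zero_homogeneous.
  exact: linear_form_homog.
have := (hM.2 d.+1 _ (sub_const_linear_forms p)).
have hc : (p.@[fun=> 0])%:MP_[n] \is 0.-homog.
  by rewrite -[_%:MP]mulr1 mul_mpolyC; apply: dhomogZ; apply: dhomog1.
by rewrite pihomogB (pihomog_ne0 _ hc) ?subr0.
Qed.

End LinearBasis.

(** * Persistence of injectivity *)

(** Multiplication by l_k is injective on the degree d part of P / J_k, for every
    k >= c. *)
Definition inj_from (K : fieldType) (n : nat) (l : 'I_n -> {mpoly K[n]})
    (I : set {mpoly K[n]}) (c d : nat) : Prop :=
  forall k : 'I_n, (c <= k)%N -> forall f, f \is d.-homog ->
    cut l I k (l k * f) -> cut l I k f.

Section Persistence.
Variables (K : fieldType) (n : nat) (A : 'M[K]_n).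
Hypothesis uA : A \in unitmx.
Variable I : set {mpoly K[n]}.
Hypothesis hI : homogeneous_ideal I.
Local Notation l := (linear_form A).
Local Notation M := (cut l [set 0]).

Let idI : is_ideal I := hI.1.
Let idZ : is_ideal [set 0 : {mpoly K[n]}] := (zero_homogeneous K n).1.
Let idM m : is_ideal (M m) := cut_ideal l idZ m.
Let hl k : l k \is 1.-homog := linear_form_homog A k.
Let hM m : homogeneous_ideal (M m) := cut_homogeneous idZ m (zero_homogeneous K n) hl.
Let idJ m : is_ideal (cut l I m) := cut_ideal l idI m.

Lemma sub_forms_cut m : M m `<=` cut l I m.
Proof.
apply: cut_min => // [p ->|k km]; first exact: ideal0 (idJ m).
by apply: cut_gen.
Qed.

Lemma cut_homogP d m p : p \is d.-homog -> cut l I m p ->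
  exists2 q, I q /\ q \is d.-homog & M m (p - q).
Proof.
move=> hp [q Iq [a e]]; exists (pihomog mdeg d q); first by split; [exact: hI.2|exact: pihomogP].
rewrite -{1}(pihomog_dE hp) -pihomogB; apply: (hM _).2.
by rewrite e addrC addKr; exists 0 => //; exists a; rewrite add0r.
Qed.

(** Above the degrees of its generators, I is P_1 times its previous component:
    the constant terms of the coefficients contribute only in degrees <= e. *)
Lemma generated_decomp e d p : generated_in_degree_le I e -> (e <= d)%N ->
  p \is d.+1.-homog -> I p ->
  exists2 g : 'I_n -> {mpoly K[n]},
    (forall k, I (g k) /\ g k \is d.-homog) & p = \sum_k l k * g k.
Proof.
move=> [G [hG eI]] ed hp; rewrite {1}eI => -[m [a [g [Gg ep]]]].
have Ig k : I (g k) by rewrite eI; apply: sub_ideal_gen.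
have /choice[b eb] k : exists b : 'I_n -> {mpoly K[n]},
    a k = ((a k).@[fun=> 0])%:MP + \sum_i l i * b i.
  have [_ -> [b eb]] := sub_const_linear_forms uA (a k); exists b.
  rewrite add0r in eb; rewrite -[LHS](subrK (((a k).@[fun=> 0])%:MP)) eb addrC.
  by congr (_ + _); apply: eq_bigl => i; rewrite ltn_ord.
exists (fun i => pihomog mdeg d (\sum_k b k i * g k)).
  move=> i; split; last exact: pihomogP.
  by apply: hI.2; apply: ideal_sum => // k _; apply: idealMl.
rewrite -[LHS](pihomog_dE hp) ep raddf_sum /=.
under [RHS]eq_bigr do rewrite -pihomog_mull // mulr_sumr raddf_sum.
rewrite exchange_big /=; apply: eq_bigr => k _.
rewrite {1}eb mulrDl pihomogD mul_mpolyC linearZ /=.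
have [dk dke hgk] := hG _ (Gg k).
rewrite (pihomog_ne0 _ hgk) ?scaler0 ?add0r; last by rewrite neq_ltn ltnS (leq_trans dke).
rewrite mulr_suml raddf_sum /=.
by apply: eq_bigr => i _; rewrite mulrA.
Qed.

Section Step.
Variables (c d : nat).
Hypothesis injd : inj_from l I c d.

(** If g = l_(m-1) f modulo the earlier forms, then l_(m-1) f is in J_(m-1), so f
    can be replaced by an element of I_d, and the difference involves one form
    fewer. *)
Lemma cap_forms_decomp m g : (c <= m <= n)%N ->
  I g -> g \is d.+1.-homog -> M m g ->
  exists2 h : 'I_n -> {mpoly K[n]}, (forall k, I (h k) /\ h k \is d.-homog) &
    M c (g - \sum_(k < n | (k < m)%N) l k * h k).
Proof.
elim: m g => [|m IH] g /andP[cm mn] Ig hg Mg.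
  exists (fun=> 0); first by move=> k; split; [exact: ideal0|exact: dhomog0].
  by rewrite big1 ?subr0 //; move: cm; rewrite leqn0 => /eqP ->.
move: cm; rewrite leq_eqVlt => /predU1P[->|]; last rewrite ltnS => cm.
  exists (fun=> 0); first by move=> k; split; [exact: ideal0|exact: dhomog0].
  by rewrite big1 ?subr0 // => k _; rewrite mulr0.
pose k := Ordinal mn.
have [r Mr [f ef]] := (cutSP l idZ k g).1 Mg.
have {Mr ef} Mr : M k (g - l k * pihomog mdeg d f).
  rewrite -pihomog_mull // -{1}(pihomog_dE hg) -pihomogB ef addrK.
  exact: (hM _).2.
have Jf : cut l I k (pihomog mdeg d f).
  apply: injd => //; first exact: pihomogP.
  rewrite -[X in cut _ _ _ X](subKr g); apply: (idealB (idJ k)); first exact: sub_cut.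
  exact: sub_forms_cut.
have [f' [If' hf'] Mf'] := cut_homogP (pihomogP _ _ _) Jf.
case: (IH (g - l k * f')).
- by rewrite cm ltnW.
- by apply: idealB => //; apply: idealMl.
- by apply: rpredB => //; apply: dhomog_mull.
- have -> : g - l k * f' = (g - l k * pihomog mdeg d f) + l k * (pihomog mdeg d f - f') by ring.
  by apply: idealD => //; apply: idealMl.
move=> h hh Mh; exists (fun i => if i == k then f' else h i).
  by move=> i; case: eqP.
rewrite (bigD1 k) //= eqxx opprD addrA.
rewrite (eq_bigl (fun i : 'I_n => (i < m)%N)); last first.
  by move=> i; rewrite ltnS [RHS]ltn_neqAle andbC.
rewrite (eq_bigr (fun i => l i * h i)) // => i im.
by case: eqP => // e; rewrite e ltnn in im.
Qed.

(** A relation l_j f = \sum_(k < m) l_k g_k modulo (l_0, ..., l_(j-1)) with the g_k in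
    I_(d+1) is shortened until l_j g_j is its last term, where it can be divided
    by l_j. *)
Lemma inj_fromS e : generated_in_degree_le I e -> (e <= d.+1)%N ->
  inj_from l I c d.+1.
Proof.
move=> genI ed j cj f hf Jf.
have [q [Iq hq] Mq] := cut_homogP (dhomog_mull (hl j) hf) Jf.
have [g hg eq] := generated_decomp genI ed hq Iq.
have [m /andP[jm mn] Mm] : exists2 m, (j < m <= n)%N &
    M j (l j * f - \sum_(k < n | (k < m)%N) l k * g k).
  exists n; first by rewrite ltn_ord leqnn.
  rewrite [X in _ - X](eq_bigl xpredT) => [|k]; last by rewrite ltn_ord.
  by rewrite -eq.
move: jm mn Mm => {q Iq hq Mq eq}; elim: m g hg => [//|m IH] g hg + mn.
pose k := Ordinal mn.
rewrite (bigD1 k) //= (eq_bigl (fun i : 'I_n => (i < m)%N)); last first.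
  by move=> i; rewrite ltnS [RHS]ltn_neqAle andbC.
rewrite ltnS leq_eqVlt => /predU1P[jm|jm] Mj.
  have ejk : k = j by apply: val_inj.
  rewrite ejk in Mj.
  have Mfg : M j (f - g j).
    apply: (linear_form_regular uA).
    have -> : l j * (f - g j) = (l j * f - (l j * g j + \sum_(i < n | (i < m)%N) l i * g i))
        + \sum_(i < n | (i < m)%N) l i * g i by ring.
    apply: idealD => //; apply: ideal_sum => // i im; rewrite mulrC; apply: idealMl => //.
    by apply: cut_gen; rewrite // jm.
  rewrite -[f](subrK (g j)); apply: (idealD (idJ j)); first exact: sub_forms_cut.
  by apply: sub_cut; case: (hg j).
have Mgk : M k (g k).
  apply: (linear_form_regular uA).
  have -> : l k * g k = l j * f - \sum_(i < n | (i < m)%N) l i * g i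
     - (l j * f - (l k * g k + \sum_(i < n | (i < m)%N) l i * g i)) by ring.
  have Ml (i : 'I_n) : (i < m)%N -> forall b, M k (l i * b).
    by move=> im b; rewrite mulrC; apply: idealMl => //; apply: cut_gen.
  apply: idealB => //; last by apply: cut_mono Mj => //; apply: ltnW.
  apply: idealB; [by []|exact: Ml|].
  by apply: ideal_sum => // i im; apply: Ml.
have cmn : (c <= m <= n)%N by rewrite (leq_trans cj (ltnW jm)) ltnW.
have [h hh Mh] := cap_forms_decomp cmn (hg k).1 (hg k).2 Mgk.
apply: (IH (fun i => g i + l k * h i)) => //; [|exact: ltnW|].
  move=> i; have [[Ig hgi] [Ih hhi]] := (hg i, hh i); split.
    by apply: idealD => //; apply: idealMl.
  by apply: rpredD => //; apply: dhomog_mull.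
under eq_bigr => i _ do rewrite mulrDr mulrCA.
rewrite big_split /= -mulr_sumr.
have -> : l j * f - (\sum_(i < n | (i < m)%N) l i * g i + l k * \sum_(i < n | (i < m)%N) l i * h i)
  = l j * f - (l k * g k + \sum_(i < n | (i < m)%N) l i * g i)
   + l k * (g k - \sum_(i < n | (i < m)%N) l i * h i) by ring.
apply: idealD => //; apply: idealMl => //.
by apply: cut_mono Mh.
Qed.

End Step.

End Persistence.

(** * Dimensions of graded components *)

Section QuotDim.
Variables (K : fieldType) (n : nat).
Local Notation P := {mpoly K[n.+1]}.
Local Notation V := (dhomog n.+1 K).

(** A subspace of maximal dimension among those inside J absorbs every element
    of J, since J is closed under sums. *)
Lemma ideal_vspace (J : set P) d : is_ideal J ->
  exists W : {vspace V d}, forall p, p \in W <-> J (val p).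
Proof.
move=> idJ.
pose sub (W : {vspace V d}) := forall p, p \in W -> J (val p).
pose has_dim m := `[< exists2 W, sub W & \dim W = m >].
have dim0 : exists m, has_dim m.
  exists 0%N; apply/asboolP; exists 0%VS; last exact: dimv0.
  by move=> p; rewrite memv0 => /eqP ->; apply: ideal0.
have dim_le m : has_dim m -> (m <= \dim {:V d})%N.
  by move=> /asboolP[W _ <-]; apply: dimvS; apply: subvf.
case: (ex_maxnP dim0 dim_le) => m /asboolP[W subW dW] maxm.
exists W => p; split; first exact: subW.
move=> Jp; have /maxm : has_dim (\dim (W + <[p]>)%VS).
  apply/asboolP; exists (W + <[p]>)%VS => // _ /memv_addP[w Ww [_ /vlineP[c ->] ->]].
  rewrite linearD linearZ /= -mul_mpolyC.
  by apply: idealD => //; [exact: subW|exact: idealMl].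
rewrite -dW => dle; have /eqP -> : W == (W + <[p]>)%VS by rewrite eqEdim addvSl.
by apply: (subvP (addvSr _ _)); apply: memv_line.
Qed.

(** The isomorphism P_d / J_d ~ K^m is given by coordinates of the projection onto
    a complement of J_d, and m is forced by the rank-nullity formula. *)
Lemma quot_dimE (J : set P) d (W : {vspace V d}) :
  (forall p, p \in W <-> J (val p)) ->
  quot_dim J d = (\dim {:V d} - \dim W)%N.
Proof.
move=> JW; rewrite /quot_dim; case: xgetP => [m _ [f [surj kerf]]|].
  have kf : lker (linfun f) = W.
    apply/vspaceP => p; rewrite memv_ker lfunE /=.
    by apply/eqP/idP => [/kerf/JW|/JW/kerf].
  have imf : limg (linfun f) = fullv.
    apply/vspaceP => v; rewrite memvf; have [p <-] := surj v.
    by rewrite -[f p]lfunE memv_img ?memvf.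
  have dm : \dim {:'rV[K]_m} = m by rewrite dimvf /dim /= mul1n.
  by rewrite -(limg_ker_dim (linfun f) fullv) capfv kf imf dm addKn.
pose U := (W^C)%VS.
pose pi := daddv_pi U W.
have dW : (U :&: W = 0)%VS by rewrite capvC capv_compl.
pose f (p : V d) : 'rV[K]_(\dim U) := \row_i coord (vbasis U) i (pi p).
have flin : linear f by move=> c p q; apply/rowP => i; rewrite !mxE !linearP.
pose F : {linear V d -> 'rV[K]_(\dim U)} := HB.pack f (GRing.isLinear.Build _ _ _ _ f flin).
move=> /(_ (\dim U)) []; exists F; split=> [v|p].
  pose w := \sum_i v 0 i *: (vbasis U)`_i.
  have Ww : w \in U.
    by apply: memv_suml => i _; apply: memvZ; apply: vbasis_mem; apply: mem_nth; rewrite size_tuple.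
  exists w; apply/rowP => i; rewrite mxE /pi daddv_pi_id //.
  by rewrite coord_sum_free // (basis_free (vbasisP _)).
rewrite -JW; split=> [f0|Wp].
  have pi0 : pi p = 0.
    rewrite (coord_vbasis (memv_pi U W p)) big1 // => i _.
    by have /rowP/(_ i) := f0; rewrite !mxE => ->; rewrite scale0r.
  have := daddv_pi_add dW (_ : p \in (U + W)%VS).
  rewrite addvC addv_complf memvf => /(_ isT); rewrite -/pi pi0 add0r => <-.
  exact: memv_pi.
have dW' : (W :&: U = 0)%VS by rewrite capv_compl.
have pi0 : pi p = 0.
  have := daddv_pi_add dW (_ : p \in (U + W)%VS).
  rewrite addvC addv_complf memvf => /(_ isT); rewrite (daddv_pi_id dW') // -/pi.
  by rewrite -[RHS]add0r => /addIr.
by apply/rowP => i; rewrite !mxE pi0 linear0.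
Qed.


Definition hpart d (p : P) : V d := DHomog (pihomogP mdeg d p).

Lemma hpart_is_linear d : linear (hpart d).
Proof. by move=> c p q; apply: val_inj; rewrite /= linearP. Qed.

HB.instance Definition _ d :=
  GRing.isLinear.Build K P (V d) _ (hpart d) (hpart_is_linear d).

Lemma hpart_id d (p : V d) : hpart d (val p) = p.
Proof. by apply: val_inj; apply: pihomog_dE; apply: dhomog_is_dhomog. Qed.

Definition mulp (l : P) d (p : V d) : V d.+1 := hpart d.+1 (l * val p).

Lemma mulp_is_linear l d : linear (@mulp l d).
Proof. by move=> c p q; rewrite /mulp linearP /= mulrDr -scalerAr linearP. Qed.

HB.instance Definition _ l d :=
  GRing.isLinear.Build K (V d) (V d.+1) _ (@mulp l d) (@mulp_is_linear l d).

Lemma mulpE l d (p : V d) : l \is 1.-homog -> val (linfun (@mulp l d) p) = l * val p.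
Proof.
move=> hl; rewrite lfunE; apply: pihomog_dE.
by apply: dhomog_mull => //; apply: dhomog_is_dhomog.
Qed.

(** The dimension count of the sequence
    (P / J)_d -> (P / J)_(d+1) -> (P / J')_(d+1) -> 0, whose first map is
    multiplication by l and is injective exactly in the case of equality. *)
Lemma quot_dim_mul (J J' : set P) (l : P) d :
  homogeneous_ideal J -> homogeneous_ideal J' -> l \is 1.-homog -> l != 0 ->
  (forall p, J' p <-> exists2 q, J q & exists a, p = q + l * a) ->
  (quot_dim J d.+1 <= quot_dim J d + quot_dim J' d.+1
     ?= iff `[< forall f, f \is d.-homog -> J (l * f)%R -> J f >])%N.
Proof.
move=> [idJ hJ] [idJ' hJ'] hl l0 J'E.
have [W JW] := ideal_vspace d idJ.
have [W1 JW1] := ideal_vspace d.+1 idJ.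
have [W1' JW1'] := ideal_vspace d.+1 idJ'.
rewrite (quot_dimE JW) (quot_dimE JW1) (quot_dimE JW1').
(* U / W is the kernel of multiplication by l on (P / J)_d. *)
pose phi := linfun (@mulp l d); pose U := (phi @^-1: W1)%VS.
have UE p : p \in U <-> J (l * val p).
  by rewrite -memv_preim JW1 mulpE.
have ker0 : lker phi = 0%VS.
  apply/eqP; rewrite -subv0; apply/subvP => p; rewrite memv_ker memv0 => /eqP/(congr1 val).
  rewrite mulpE // => /eqP; rewrite mulf_eq0 (negPf l0) /= => /eqP p0.
  by apply/eqP; apply: val_inj.
have W1'E : W1' = (W1 + phi @: fullv)%VS.
  apply/vspaceP => p; apply/idP/idP.
    move/JW1'/J'E => [q Jq [a e]].
    rewrite -(hpart_id p) e linearD /=; apply: memv_add.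
      by apply/JW1; apply: hJ.
    have -> : hpart d.+1 (l * a) = phi (hpart d a).
      by apply: val_inj; rewrite mulpE //= pihomog_mull.
    by apply: memv_img; apply: memvf.
  case/memv_addP => w /JW1 Jw [_ /memv_imgP[f _ ->] ->]; apply/JW1'/J'E.
  by exists (val w) => //; exists (val f); rewrite linearD /= mulpE.
have cap : (W1 :&: phi @: fullv)%VS = (phi @: U)%VS.
  apply/vspaceP => p; rewrite memv_cap; apply/andP/memv_imgP.
    by case=> Wp /memv_imgP[f _ e]; exists f => //; rewrite -memv_preim -e.
  by case=> f; rewrite -memv_preim => Wf ->; split=> //; apply: memv_img; apply: memvf.
have dimi X : \dim (phi @: X) = \dim X.
  by apply: limg_dim_eq; rewrite ker0 capv0.
have := dimv_sum_cap W1 (phi @: fullv)%VS; rewrite -W1'E cap !dimi => dimE.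
have WU : (W <= U)%VS by apply/subvP => p /JW Jp; apply/UE; apply: idealMl.
have [leWU eqWU] := dimv_leqif_eq WU.
have -> : `[< forall f, f \is d.-homog -> J (l * f) -> J f >] = (W == U).
  apply/asboolP/eqP => [injl|WeU f hf].
    apply/vspaceP => p; apply/idP/idP; first exact: (subvP WU).
    by move=> Up; apply/JW; apply: injl; [apply: dhomog_is_dhomog|apply/UE].
  have := UE (DHomog hf); have := JW (DHomog hf); rewrite WeU /=.
  by move=> <- <-.
have := dimvS (subvf W1'); have := dimvS (subvf U); have := dimvS (subvf W1).
move: eqWU leWU dimE; rewrite -!/(dimv _).
move: (\dim W) (\dim U) (\dim W1) (\dim W1') (\dim {:V d}) (\dim {:V d.+1}).
move=> w u w1 w1' N N1 <- *; split; first by lia.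
by apply/eqP/eqP; lia.
Qed.

Section Growth.
Variable A : 'M[K]_n.+1.
Hypothesis uA : A \in unitmx.
Variable I : set P.
Hypothesis hI : homogeneous_ideal I.
Local Notation l := (linear_form A).

(** The bounds of [quot_dim_mul] telescope, ending with the vanishing of positive
    degrees modulo all the forms. The total is sharp only if every bound is. *)
Lemma growth_leqif i d : (i <= n.+1)%N ->
  (quot_dim (cut l I (n.+1 - i)) d.+1 <=
     \sum_(1 <= j < i.+1) quot_dim (cut l I (n.+1 - j)) d
     ?= iff `[< inj_from l I (n.+1 - i) d >])%N.
Proof.
elim: i => [_|i IH ni].
  rewrite big_geq // subn0 (_ : quot_dim _ _ = 0%N); last first.
    rewrite (@quot_dimE _ _ fullv) ?subnn // => p; rewrite memvf; split=> // _.
    apply: (sub_forms_cut hI); apply: (dhomogS_linear_forms uA (d := d)).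
    exact: dhomog_is_dhomog.
  split=> //; rewrite eqxx; apply/esym/asboolP => k.
  by rewrite leqNgt ltn_ord.
have [le1 eq1] := IH (ltnW ni).
have kn : (n.+1 - i.+1 < n.+1)%N by lia.
pose k := Ordinal kn.
have kS : (n.+1 - i = k.+1)%N by rewrite /k /=; lia.
have hJ m := cut_homogeneous hI.1 m hI (linear_form_homog A).
have [le2 eq2] := quot_dim_mul d (hJ k) (hJ k.+1)
  (linear_form_homog A k) (linear_form_neq0 uA k) (cutSP l hI.1 k).
rewrite kS in le1 eq1; rewrite big_nat_recr //=; split.
  by rewrite -[X in cut _ _ X]/(nat_of_ord k); lia.
have -> : `[< inj_from l I k d >] =
    `[< forall f : P, f \is d.-homog -> cut l I k (l k * f) -> cut l I k f >]
    && `[< inj_from l I k.+1 d >].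
  apply/asboolP/andP => [inj|[/asboolP injk /asboolP inj] j].
    by split; apply/asboolP; [apply: inj|move=> j /ltnW; apply: inj].
  by rewrite leq_eqVlt => /predU1P[/ord_inj <-|]; [|exact: inj].
rewrite -eq1 -eq2 /= -/k.
apply/eqP/andP => [e|[/eqP e1 /eqP e2]]; last by move: e1 e2 => /=; lia.
by split; apply/eqP; move: le1 le2 e => /=; lia.
Qed.

End Growth.

End QuotDim.

(** * Generic matrices *)

Section Generic.
Variable K : fieldType.

Definition mxeval r n (f : {mpoly K[r * n]}) (A : 'M[K]_(r, n)) : K :=
  f.@[fun k => mxvec A 0 k].

(** A nonvanishing value of f, rather than f != 0, is required: it makes the
    principal open set nonempty without any hypothesis on K, and it is what
    pulling back to larger matrices preserves directly. *)
Definition generically r n (P : set 'M[K]_(r, n)) : Prop :=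
  exists2 f : {mpoly K[r * n]}, exists A, mxeval f A != 0 &
    forall A, mxeval f A != 0 -> P A.

Lemma generically_imp r n (P Q : set 'M[K]_(r, n)) :
  P `<=` Q -> generically P -> generically Q.
Proof. by move=> PQ [f nzf fP]; exists f => // A /fP/PQ. Qed.

Lemma generically_inhabited r n (P : set 'M[K]_(r, n)) :
  generically P -> exists A, P A.
Proof. by move=> [f [A fA] fP]; exists A; apply: fP. Qed.

Lemma meval_line N (f : {mpoly K[N]}) (u v : 'I_N -> K) :
  exists q : {poly K}, forall t, q.[t] = f.@[fun i => u i + t * (v i - u i)].
Proof.
exists (\sum_(m <- msupp f) f@_m *: \prod_i ((u i)%:P + (v i - u i) *: 'X) ^+ m i).
move=> t; rewrite mevalE horner_sum; apply: eq_bigr => m _.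
rewrite hornerZ horner_prod; congr (_ * _); apply: eq_bigr => i _.
by rewrite horner_exp hornerD hornerC hornerZ hornerX [t * _]mulrC.
Qed.

Hypothesis charK : [pchar K] =i pred0.

Lemma poly_nonroot (p : {poly K}) : p != 0 -> exists t, p.[t] != 0.
Proof.
move=> p0; apply: contrapT => nex.
have := @max_poly_roots _ p [seq i%:R | i <- iota 0 (size p)] p0.
rewrite size_map size_iota ltnn => abs; suff: false by []; apply: abs.
  by apply/allP => t _; apply/negPn/negP => pt; apply: nex; exists t.
rewrite map_inj_uniq ?iota_uniq //.
suff natrI i j : (i <= j)%N -> i%:R = j%:R :> K -> i = j.
  move=> i j e; case/orP: (leq_total i j) => [/natrI|/natrI h]; first exact.
  by apply/esym/h.
move=> ij /esym/eqP; rewrite -subr_eq0 -natrB // ((pcharf0P K).1 charK).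
by rewrite subn_eq0 => ji; apply/eqP; rewrite eqn_leq ij.
Qed.

(** Restricting to the line through A and B reduces this to one variable, where
    the product of two nonzero polynomials has a nonroot. *)
Lemma mxeval_common r n (f g : {mpoly K[r * n]}) A B :
  mxeval f A != 0 -> mxeval g B != 0 ->
  exists C, mxeval f C != 0 /\ mxeval g C != 0.
Proof.
move=> fA gB.
have [qf qfE] := meval_line f (fun k => mxvec A 0 k) (fun k => mxvec B 0 k).
have [qg qgE] := meval_line g (fun k => mxvec A 0 k) (fun k => mxvec B 0 k).
have [t] : exists t, (qf * qg).[t] != 0.
  apply: poly_nonroot; apply: mulf_neq0.
    apply: contraNneq fA => q0; rewrite /mxeval.
    have := qfE 0; rewrite q0 horner0 => e; apply/eqP; rewrite [RHS]e.
    by apply: meval_eq => k; rewrite mul0r addr0.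
  apply: contraNneq gB => q0; rewrite /mxeval.
  have := qgE 1; rewrite q0 horner0 => e; apply/eqP; rewrite [RHS]e.
  by apply: meval_eq => k; rewrite mul1r addrC subrK.
rewrite hornerM mulf_eq0 negb_or => /andP[ft gt].
exists (A + t *: (B - A)); move: ft gt; rewrite qfE qgE /mxeval.
have E k : mxvec (A + t *: (B - A)) 0 k = mxvec A 0 k + t * (mxvec B 0 k - mxvec A 0 k).
  by rewrite linearD linearZ linearB !mxE.
by rewrite !(meval_eq _ E).
Qed.

Lemma generically_and r n (P Q : set 'M[K]_(r, n)) :
  generically P -> generically Q -> generically (P `&` Q).
Proof.
move=> [f [A fA] fP] [g [B gB] gQ]; have [C [fC gC]] := mxeval_common fA gB.
exists (f * g).
  by exists C; rewrite /mxeval mevalM; apply: mulf_neq0.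
by move=> D; rewrite /mxeval mevalM mulf_eq0 negb_or => /andP[/fP PD /gQ QD].
Qed.

Lemma generically_all r n (T : eqType) (s : seq T) (P : T -> set 'M[K]_(r, n)) :
  (forall t, t \in s -> generically (P t)) ->
  generically [set A | forall t, t \in s -> P t A].
Proof.
elim: s => [|t s IH] gP.
  by exists 1 => // ; exists 0; rewrite /mxeval meval1 oner_neq0.
have gt := gP t (mem_head _ _).
have {}IH := IH (fun t' ts => gP t' (mem_behead (s := t :: s) ts)).
apply: generically_imp (generically_and gt IH) => A [PA PsA] t'.
by rewrite inE => /predU1P[->|/PsA].
Qed.

Lemma generically_unit n : generically [set A : 'M[K]_n | A \in unitmx].
Proof.
pose X : 'M[{mpoly K[n * n]}]_n := \matrix_(i, j) 'X_(mxvec_index i j).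
have XE A : mxeval (\det X) A = \det A.
  rewrite /mxeval -det_map_mx; congr (\det _).
  by apply/matrixP => i j; rewrite !mxE /= mevalXU mxvecE.
exists (\det X); first by exists 1%:M; rewrite XE det1 oner_neq0.
by move=> A; rewrite XE /= unitmxE unitfE.
Qed.

Lemma generically_rowsub r s n (rs : (r <= s)%N) (P : set 'M[K]_(r, n)) :
  generically P -> generically [set A : 'M[K]_(s, n) | P (rowsub (widen_ord rs) A)].
Proof.
move=> [f [A fA] fP].
pose idx : 'M['I_(s * n)]_(r, n) := \matrix_(i, j) mxvec_index (widen_ord rs i) j.
pose g := f \mPo [tuple 'X_(mxvec idx 0 k) | k < r * n].
have gE B : mxeval g B = mxeval f (rowsub (widen_ord rs) B).
  rewrite /mxeval /g comp_mpoly_meval; apply: meval_eq => k.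
  by rewrite tnth_mktuple mevalXU; case/mxvec_indexP: k => i j; rewrite !mxvecE !mxE mxvecE.
exists g; last by move=> B; rewrite gE => /fP.
(* A nonvanishing point, extended by zero rows. *)
exists (\matrix_(i, j) if insub (i : nat) is Some i' then A i' j else 0).
rewrite gE; congr (mxeval f _ != 0): fA; apply/matrixP => i j; rewrite !mxE.
by rewrite /= (insubT (fun k => k < r)%N (ltn_ord i)); congr (A _ _); apply: val_inj.
Qed.

End Generic.

Section GenericDim.
Variables (K : fieldType) (n : nat).
Local Notation P := {mpoly K[n.+1]}.
Local Notation V := (dhomog n.+1 K).
Variable I : set P.
Hypothesis hI : homogeneous_ideal I.
Variables (r d : nat).

Let J (A : 'M[K]_(r, n.+1)) := cut (linear_form A) I r.

(** The dimension of (J_A)_d is lower semicontinuous in A. Choose A0 where it is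
    maximal, with a basis b of (J_A0)_d; writing each basis element in terms of I
    and the forms of A0 and replacing these by the forms of A deforms b into a
    family w of elements of (J_A)_d. The coordinates of w along b are affine in
    the entries of A, and their determinant is 1 at A0. *)
Lemma generically_quot_dim :
  exists m, generically [set A : 'M[K]_(r, n.+1) | quot_dim (J A) d = m].
Proof.
have hJ A : homogeneous_ideal (J A).
  exact: (cut_homogeneous hI.1 r hI (linear_form_homog A)).
have [W WJ] : {W : 'M[K]_(r, n.+1) -> {vspace V d} &
    forall A p, p \in W A <-> J A (val p)}.
  apply: (@choice _ _ (fun A (U : {vspace V d}) => forall p, p \in U <-> J A (val p))).
  by move=> A; apply: ideal_vspace; case: (hJ A).
pose has_dim m := `[< exists A, \dim (W A) = m >].
have dim0 : exists m, has_dim m by exists (\dim (W 0)); apply/asboolP; exists 0.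
have dim_le m : has_dim m -> (m <= \dim {:V d})%N.
  by move=> /asboolP[A <-]; apply: dimvS; apply: subvf.
case: (ex_maxnP dim0 dim_le) => m /asboolP[A0 dW0] maxm.
exists (\dim {:V d} - m)%N.
suff [f [A fA] fP] : generically [set A | (m <= \dim (W A))%N].
  exists f; first by exists A.
  move=> B /fP /= mB; rewrite /= (quot_dimE (WJ B)); congr (_ - _)%N.
  by apply/eqP; rewrite eqn_leq mB andbT; apply: maxm; apply/asboolP; exists B.
move: (vbasis (W A0)) (vbasisP (W A0)); rewrite dW0 => b bP.
have Wb (i : 'I_m) : J A0 (val b`_i).
  by apply/WJ; apply: (basis_mem bP); apply: mem_nth; rewrite size_tuple.
have /choice[q /all_and2[Iq /choice[a qaE]]] : forall i : 'I_m, exists q : P, I q /\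
    exists a : 'I_r -> P, val b`_i = q + \sum_(k < r) linear_form A0 k * a k.
  move=> i; have [q Iq [a ->]] := Wb i; exists q; split=> //; exists a.
  by congr (_ + _); apply: eq_bigl => k; rewrite ltn_ord.
pose w A i := hpart d (q i + \sum_(k < r) linear_form A k * a i k).
have Ww A i : w A i \in W A.
  apply/WJ; apply: (hJ A).2; exists (q i) => //; exists (a i).
  by congr (_ + _); apply: eq_bigl => k; rewrite ltn_ord.
pose D A := \matrix_(i < m, j < m) coord b j (w A i).
pose X : 'M[{mpoly K[r * n.+1]}]_m := \matrix_(i, j)
  ((coord b j (hpart d (q i)))%:MP +
   \sum_(k < r) \sum_(t < n.+1) coord b j (hpart d ('X_t * a i k)) *: 'X_(mxvec_index k t)).
have XE A : mxeval (\det X) A = \det (D A).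
  rewrite /mxeval -det_map_mx; congr (\det _); apply/matrixP => i j; rewrite !mxE /=.
  rewrite mevalD mevalC /w !linearD /= !linear_sum /=; congr (_ + _); apply: eq_bigr => k _.
  rewrite /linear_form mulr_suml !linear_sum /=; apply: eq_bigr => t _.
  by rewrite mevalZ mevalXU mxvecE -scalerAl !linearZ /= mulrC.
exists (\det X).
  exists A0; rewrite XE (_ : D A0 = 1%:M) ?det1 ?oner_neq0 //.
  apply/matrixP => i j; rewrite !mxE /w -qaE hpart_id coord_free //.
  exact: basis_free bP.
move=> A; rewrite XE => detA /=.
pose wt := [tuple w A i | i < m].
have free_wt : free wt.
  apply/freeP => k; under eq_bigr => i _ do rewrite -tnth_nth tnth_mktuple.
  move=> kw i.
  have kD : (\row_i k i) *m D A = 0.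
    apply/rowP => j; rewrite !mxE.
    under eq_bigr => i' _ do rewrite !mxE -linearZ.
    by rewrite -linear_sum kw linear0.
  have uD : D A \in unitmx by rewrite unitmxE unitfE.
  have : \row_i k i = 0 by rewrite -[LHS](mulmxK uD) kD mul0mx.
  by move/rowP/(_ i); rewrite !mxE.
move: free_wt; rewrite /free size_tuple => /eqP <-.
by apply: dimvS; apply/span_subvP => _ /tnthP[i ->]; rewrite tnth_mktuple.
Qed.

End GenericDim.

(** * Sectional matrices *)

Section SectionalMatrix.
Variables (K : fieldType) (n : nat).
Hypothesis charK : [pchar K] =i pred0.
Variable I : set {mpoly K[n.+1]}.
Hypothesis hI : homogeneous_ideal I.

Lemma generically_sectional_matrix i d :
  generically [set A : 'M[K]_(n.+1 - i, n.+1) |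
    quot_dim (cut (linear_form A) I (n.+1 - i)) d = sectional_matrix I i d].
Proof.
have [m [f [A0 fA0] fm]] := generically_quot_dim hI (n.+1 - i) d.
pose Q := [set m | exists U : set 'M[K]_(n.+1 - i, n.+1),
    [/\ zariski_open U, U !=set0 & forall A, U A ->
      quot_dim (ideal_gen (I `|` range (linear_form A))) d = m]].
have : Q (sectional_matrix I i d).
  apply: xgetPex; exists m, [set A | mxeval f A != 0]; split; last 1 first.
  - by move=> A /fm; rewrite /= (cut_ideal_gen _ hI.1).
  - exists [set f]; apply/seteqP; split=> A; first by exists f.
    by case=> g ->.
  - by exists A0.
case=> _ [[F ->] [A [g Fg gA]] UE].
exists g; first by exists A.
by move=> B gB; rewrite /= (cut_ideal_gen _ hI.1); apply: UE; exists g.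
Qed.

(** A single basis of linear forms computes all the entries of the sectional matrix
    in the degrees ds: the first n.+1 - i of its forms serve as the generic forms
    for the entry at i. *)
Definition generic_basis (A : 'M[K]_n.+1) (ds : seq nat) :=
  A \in unitmx /\ forall i d, (1 <= i <= n.+1)%N -> d \in ds ->
    quot_dim (cut (linear_form A) I (n.+1 - i)) d = sectional_matrix I i d.

Lemma generic_basis_exists ds : exists A, generic_basis A ds.
Proof.
pose E (id : nat * nat) : set 'M[K]_n.+1 := [set A |
  quot_dim (cut (linear_form A) I (n.+1 - id.1)) id.2 = sectional_matrix I id.1 id.2].
pose s := [seq (i, d) | i <- iota 1 n.+1, d <- ds].
have gE : generically [set A | forall id, id \in s -> E id A].
  apply: generically_all => // -[i d] _.
  apply: generically_imp (generically_rowsub (leq_subr i n.+1) (generically_sectional_matrix i d)).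
  move=> A; rewrite /E /=.
  have -> : linear_form (rowsub (widen_ord (leq_subr i n.+1)) A) =
      linear_form A \o widen_ord (leq_subr i n.+1).
    by apply/funext => k; apply: eq_bigr => j _; rewrite !mxE.
  by rewrite cut_widen //; case: hI.
have [A [uA EA]] := generically_inhabited (generically_and charK (generically_unit K n.+1) gE).
exists A; split=> // i d i1n dds; apply: (EA (i, d)).
by apply: allpairs_f => //; rewrite mem_iota addnC addn1.
Qed.

Lemma maximal_growth_inj_from A i d : generic_basis A [:: d; d.+1] ->
  (1 <= i <= n.+1)%N ->
  maximal_growth I i d <-> inj_from (linear_form A) I (n.+1 - i) d.
Proof.
move=> [uA AE] i1n; have [_ eqi] := growth_leqif uA hI d (proj2 (andP i1n)).
rewrite /maximal_growth -AE ?inE ?eqxx ?orbT //.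
rewrite (eq_big_nat _ _ (F2 := fun j => quot_dim (cut (linear_form A) I (n.+1 - j)) d)).
  by split=> [/eqP|inj]; [rewrite eqi => /asboolP|apply/eqP; rewrite eqi; apply/asboolP].
move=> j /andP[j1 ji]; rewrite AE ?inE ?eqxx // j1.
by case/andP: i1n => _; apply: leq_trans.
Qed.

Lemma maximal_growthS e i d : generated_in_degree_le I e -> (e <= d.+1)%N ->
  (1 <= i <= n.+1)%N -> maximal_growth I i d -> maximal_growth I i d.+1.
Proof.
move=> genI ed i1n; have [A [uA AE]] := generic_basis_exists [:: d; d.+1; d.+2].
have gb k : k \in [:: d; d.+1] -> generic_basis A [:: k; k.+1].
  move=> kd; split=> // j d' j1n d'k; apply: AE => //.
  by move: kd d'k; rewrite !inE => /pred2P[]-> /pred2P[]->; rewrite eqxx ?orbT.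
move=> /(maximal_growth_inj_from (gb d _) i1n) inj.
apply/(maximal_growth_inj_from (gb d.+1 _) i1n); first by rewrite !inE eqxx orbT.
apply: (inj_fromS uA hI) genI ed; apply: inj; by rewrite inE eqxx.
Qed.

Lemma maximal_growth_le i j d : (1 <= j <= i)%N -> (i <= n.+1)%N ->
  maximal_growth I i d -> maximal_growth I j d.
Proof.
move=> /andP[j1 ji] i_n; have [A gA] := generic_basis_exists [:: d; d.+1].
have i1n : (1 <= i <= n.+1)%N by rewrite i_n (leq_trans j1).
have j1n : (1 <= j <= n.+1)%N by rewrite j1 (leq_trans ji).
move=> /(maximal_growth_inj_from gA i1n) inj.
apply/(maximal_growth_inj_from gA j1n) => k jk; apply: inj.
exact: leq_trans (leq_sub2l _ ji) jk.
Qed.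

End SectionalMatrix.

Local Close Scope classical_set_scope.
Local Close Scope ring_scope.

Theorem theorem4p6 (K : fieldType) (charK : [pchar K]%R =i pred0) (n : nat)
    (I : set {mpoly K[n]}) (delta : nat) :
  homogeneous_ideal I ->
  generated_in_degree_le I delta.+1 ->
  forall i : nat, 1 <= i <= n ->
  maximal_growth I i delta ->
  forall j d : nat, 1 <= j <= i -> delta <= d ->
  maximal_growth I j d.
Proof.
case: n I => [|n] I hI genI i i1n; first by case: i i1n.
move=> max j d j1i /subnK <-; have [_ i_n] := andP i1n.
apply: (maximal_growth_le charK hI j1i i_n).
elim: (d - delta)%N => [//|k IH].
by apply: (maximal_growthS charK hI genI) => //; rewrite ltnS leq_addl.
Qed.
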